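(* Let $(X,F,T)$ be a sampling scheme for $\mathcal{H}$, with $T=\{t_j\}_{j\in\mathbb{J}}$ and $F=\{f_j\}_{j\in\mathbb{J}}$, let $\Lambda\subset\mathbb{J}$ be an erasure set satisfying the minimal redundancy condition, and let $\Omega\subset\mathbb{J}\setminus\Lambda$ be a robust bridge set for $\Lambda$. Suppose that the complex matrix $C=\left(\overline{c_j^{(k)}}\right)_{j\in\Omega,\,k\in\Lambda}$ solves the bridging equation $$B(\Lambda,\Omega)\,C=B(\Lambda,\Lambda),$$ where $B(\Lambda,\Omega)=(f_j(t_k))_{j\in\Lambda,\,k\in\Omega}$ and $B(\Lambda,\Lambda)=(f_j(t_k))_{j,k\in\Lambda}$. For $f\in\mathcal{H}$ let $f_R=\sum_{j\in\mathbb{J}\setminus\Lambda}f(t_j)f_j$. Then for every $f\in\mathcal{H}$, $$(f(t_j))_{j\in\Lambda}=C^T\big((f(t_j))_{j\in\Omega}-(f_R(t_j))_{j\in\Omega}\big)+(f_R(t_j))_{j\in\Lambda},$$ where $C^T$ denotes the transpose of $C$ (and the tuples are viewed as column vectors).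
   Context: A frame for a Hilbert space $\mathcal{H}$ is a finite or countable sequence $\{g_j\}_{j\in\mathbb{J}}$ in $\mathcal{H}$ for which there are constants $0<A\le B<\infty$ with $A\|f\|^2\le\sum_{j}|\langle f,g_j\rangle|^2\le B\|f\|^2$ for all $f\in\mathcal{H}$. A dual of a frame $\{g_j\}$ is a frame $\{f_j\}_{j\in\mathbb{J}}$ with $f=\sum_{j}\langle f,g_j\rangle f_j$ (norm convergence) for all $f\in\mathcal{H}$. Sampling scheme: $X$ is a metric space, $\mu$ a Borel measure on $X$, $\mathcal{H}$ a closed subspace of $L^2(X,\mu)$ consisting of continuous functions, $T=\{t_j\}_{j\in\mathbb{J}}\subset X$ ($\mathbb{J}$ finite or countable), and the sampling transform $\Theta(f)=(f(t_j))_{j\in\mathbb{J}}$ maps $\mathcal{H}$ into $\ell^2(\mathbb{J})$ and is bounded and bounded below. Then by the Riesz representation theorem there are $g_j\in\mathcal{H}$ with $f(t_j)=\langle f,g_j\rangle$ for all $f\in\mathcal{H}$, and $G=\{g_j\}_{j\in\mathbb{J}}$ is a frame for $\mathcal{H}$. Let $F=\{f_j\}_{j\in\mathbb{J}}$ be a dual frame of $G$, so that $f=\sum_{j\in\mathbb{J}}f(t_j)f_j$ for all $f\in\mathcal{H}$. Then $(X,F,T)$ is called a sampling scheme for $\mathcal{H}$. An erasure set is a finite subset $\Lambda\subset\mathbb{J}$; it satisfies the minimal redundancy condition if $\overline{\mathrm{span}}\{g_j:j\notin\Lambda\}=\mathcal{H}$. A bridge set for $\Lambda$ is a finite set $\Omega\subset\mathbb{J}\setminus\Lambda$.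 It is robust if the equation $B(\Lambda,\Omega)C=B(\Lambda,\Lambda)$ has a solution $C$ (a complex matrix with rows indexed by $\Omega$ and columns by $\Lambda$), where $B(\Lambda,\Omega)$ has rows indexed by $\Lambda$ and columns by $\Omega$. *)

(* Defs.v *)
From HB Require Import structures.
From mathcomp Require Import all_boot all_order all_algebra finmap.
From mathcomp Require Import complex.
From mathcomp Require Import all_classical all_reals all_analysis.
From mathcomp Require summability.

Set Implicit Arguments.
Unset Strict Implicit.
Unset Printing Implicit Defensive.
Import Order.TTheory GRing.Theory Num.Theory.
Import numFieldNormedType.Exports.
Local Open Scope classical_set_scope.
Local Open Scope ring_scope.
Local Open Scope complex_scope.

(* A measurableType is pointed, so a metric space that
   carries a Borel measure has to be pointed (i.e. nonempty). *)
#[short(type="pmetricType")]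
HB.structure Definition PMetric (K : numDomainType) :=
  {X of Metric K X & Pointed X}.

Notation borel X := (g_sigma_algebraType (@open X)).

Section L2.
Context {R : realType} {X : pmetricType R}.
Variable mu : {measure set (borel X) -> \bar R}.
Implicit Types (f g h : X -> R[i]) (H : set (X -> R[i])).

Definition L2norm f : \bar R :=
  Lnorm mu 2%:E (fun x => (Normc.normc (f x))%:E).

Definition L2 : set (X -> R[i]) :=
  [set f | [/\ measurable_fun [set: borel X] (fun x => complex.Re (f x)),
               measurable_fun [set: borel X] (fun x => complex.Im (f x)) &
               (L2norm f < +oo)%E]].

Definition inner f g : R[i] :=
  (\int[mu]_x complex.Re (f x * (g x)^*)) +i*
  (\int[mu]_x complex.Im (f x * (g x)^*)).

(* The elements of L^2(X, mu) are classes of functions modulo equality mu-a.e.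
   A closed subspace consisting of continuous functions is represented by a
   linear space H of continuous functions that contains exactly one
   representative of each class (cs_separated), so that f(x) is meaningful
   for f in H; cs_closed says that the set of classes is closed in
   L^2(X, mu). *)
Record closed_subspace_of_continuous H : Prop := {
  cs_L2 : H `<=` L2 ;
  cs_continuous : forall f, H f -> continuous (f : X -> (R[i] : numFieldType)) ;
  cs_zero : H (fun=> 0) ;
  cs_linear : forall (a : R[i]) f g, H f -> H g -> H (fun x => a * f x + g x) ;
  cs_separated : forall f g, H f -> H g ->
    {ae mu, forall x : borel X, f x = g x} -> f = g ;
  cs_closed : forall f, L2 f ->
    (forall e : R, 0 < e ->
       exists2 h, H h & (L2norm (fun x => (f x - h x)%R) < e%:E)%E) ->
    exists2 h, H h & {ae mu, forall x : borel X, h x = f x} }.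

Definition closed_span H (V : set (X -> R[i])) : set (X -> R[i]) :=
  [set h | H h /\ forall e : R, 0 < e ->
     exists n (a : 'I_n -> R[i]) (v : 'I_n -> X -> R[i]),
       (forall i, V (v i)) /\
       (L2norm (fun x => (h x - \sum_(i < n) a i * v i x)%R) < e%:E)%E].

Section Frames.
Context {J : countType}.
Implicit Types (u : J -> X -> R[i]) (P : pred J).

Definition ell2norm (a : J -> R[i]) : \bar R :=
  ((\esum_(j in [set: J]) ((Normc.normc (a j)) ^+ 2)%:E) `^ 2^-1)%E.

(* The countable index set J has no preferred order: s is the sum of the u j
   with P j if the finite partial sums converge to s in norm along the
   directed set of finite subsets of J. For the frame expansions below this
   agrees with summation along any enumeration of J. *)
Definition sums_to P u (s : X -> R[i]) : Prop :=
  (fun S : {fset J} =>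
     L2norm (fun x => s x - \sum_(j <- S | P j) u j x)) @ summability.totally
  --> 0%E.

(* The sum in H; it is unique because H is separated, and it is 0 by
   convention if the family is not summable. *)
Definition sum_in H P u : X -> R[i] :=
  xget (fun=> 0) [set s | H s /\ sums_to P u s].

Definition frame H (g : J -> X -> R[i]) : Prop :=
  (forall j, H (g j)) /\
  exists A B : R, [/\ 0 < A, A <= B & forall f, H f ->
    (A%:E * L2norm f ^+ 2 <=
       \esum_(j in [set: J]) ((Normc.normc (inner f (g j))) ^+ 2)%:E)%E /\
    (\esum_(j in [set: J]) ((Normc.normc (inner f (g j))) ^+ 2)%:E <=
       B%:E * L2norm f ^+ 2)%E].

Definition dual_frame H (g F : J -> X -> R[i]) : Prop :=
  frame H F /\
  forall f, H f -> sums_to predT (fun j x => inner f (g j) * F j x) f.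

Definition sampling (t : J -> X) f : J -> R[i] := fun j => f (t j).

(* (X, F, T) is a sampling scheme for H, where T is the family t and g is the
   family of Riesz representers of the evaluations at the points of T. *)
Record sampling_scheme H (t : J -> X) (g F : J -> X -> R[i]) : Prop := {
  ss_space : closed_subspace_of_continuous H ;
  ss_ell2 : forall f, H f -> (ell2norm (sampling t f) < +oo)%E ;
  ss_bounded : exists2 K : R, 0 < K & forall f, H f ->
    (ell2norm (sampling t f) <= K%:E * L2norm f)%E ;
  ss_bounded_below : exists2 k : R, 0 < k & forall f, H f ->
    (k%:E * L2norm f <= ell2norm (sampling t f))%E ;
  ss_riesz_mem : forall j, H (g j) ;
  ss_riesz : forall f, H f -> forall j, f (t j) = inner f (g j) ;
  ss_dual : dual_frame H g F }.

Definition minimal_redundancy H (g : J -> X -> R[i]) (Lambda : {fset J}) :=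
  closed_span H [set g j | j in [set j | j \notin Lambda]] = H.

Definition partial_reconstruction H (t : J -> X) (F : J -> X -> R[i])
    (Lambda : {fset J}) f : X -> R[i] :=
  sum_in H [pred j | j \notin Lambda] (fun j x => f (t j) * F j x).

End Frames.
End L2.

Section Bridging.
Context {R : realType} {X : pmetricType R} {J : countType}.

(* Matrices and vectors indexed by a finite D : {fset J} are indexed by
   'I_#|{: D}|, through the enumeration of the elements of D. *)
Definition elt (D : {fset J}) (i : 'I_#|{: D}|) : J := fsval (enum_val i).

Definition bridge_matrix (t : J -> X) (F : J -> X -> R[i])
    (D E : {fset J}) : 'M[R[i]]_(#|{: D}|, #|{: E}|) :=
  \matrix_(j, k) F (elt j) (t (elt k)).

Definition bridge_set (Lambda Omega : {fset J}) : Prop :=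
  [disjoint Omega & Lambda]%fset.

Definition robust (t : J -> X) (F : J -> X -> R[i])
    (Lambda Omega : {fset J}) : Prop :=
  exists C : 'M[R[i]]_(#|{: Omega}|, #|{: Lambda}|),
    bridge_matrix t F Lambda Omega *m C = bridge_matrix t F Lambda Lambda.

Definition samples (t : J -> X) (D : {fset J}) (f : X -> R[i]) :
    'cV[R[i]]_(#|{: D}|) :=
  \col_j f (t (elt j)).

End Bridging.

(* Main.v *)
Require Import Defs.
From HB Require Import structures.
From mathcomp Require Import all_boot all_order all_algebra finmap.
From mathcomp Require Import complex.
From mathcomp Require Import all_classical all_reals all_analysis.
From mathcomp Require Import measurable_realfun.
From mathcomp Require summability.

(** Why the theorem holds.  Removing the finitely many terms indexed by Lambda
    from the convergent expansion of f shows that f_R = f - f_E, where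
    f_E = sum_(j in Lambda) f(t_j) f_j ([partial_reconstructionE]).  Sampling
    f - f_R = f_E along any finite set D therefore gives

      f|D - f_R|D = B(Lambda, D)^T f|Lambda.

    For D = Omega, multiplying on the left by C^T turns the matrix into
    (B(Lambda, Omega) C)^T = B(Lambda, Lambda)^T, and the case D = Lambda of the
    same identity says that the product is f|Lambda - f_R|Lambda.

    The analytic content is that f_R, defined as some chosen sum of a family in
    H, is the function f - f_E pointwise.  This needs sums in H to be unique
    as functions ([sums_to_unique]): the triangle inequality in L^2 makes two
    sums equal almost everywhere, and almost everywhere equal functions of H
    coincide. *)

Set Implicit Arguments.
Unset Strict Implicit.
Unset Printing Implicit Defensive.
Import Order.TTheory GRing.Theory Num.Theory.
Import numFieldNormedType.Exports.
Local Open Scope classical_set_scope.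
Local Open Scope ring_scope.
Local Open Scope complex_scope.

Section SumInClosedSubspace.
Context {R : realType} {X : pmetricType R}.
Variable mu : {measure set (borel X) -> \bar R}.
Implicit Types (f g h : X -> R[i]) (H : set (X -> R[i])).

Lemma L2_measurable_normc f : L2 mu f ->
  measurable_fun [set: borel X] (fun x => Normc.normc (f x)).
Proof.
move=> [mRe mIm _].
have -> : (fun x => Normc.normc (f x)) =
    Num.sqrt \o (fun x => complex.Re (f x) ^+ 2 + complex.Im (f x) ^+ 2).
  by apply/funext => x /=; case: (f x).
apply: measurableT_comp.
  by apply: continuous_measurable_fun; exact: sqrt_continuous.
by apply: measurable_funD; exact: measurable_funX.
Qed.

(** Minkowski's inequality for the real functions |f| and |g|, combined with the
    pointwise bound |f - g| <= |f| + |g|. *)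
Lemma L2norm_triangle f g : L2 mu f -> L2 mu g -> L2 mu (fun x => f x - g x) ->
  (L2norm mu (fun x => (f x - g x)%R) <= L2norm mu f + L2norm mu g)%E.
Proof.
move=> /L2_measurable_normc mf /L2_measurable_normc mg /L2_measurable_normc mfg.
have le12 : 1 <= 2 :> R by rewrite ler1n.
apply: le_trans (minkowski_EFin mu mf mg le12).
rewrite /L2norm unlock /Lnorm.
apply: gt0_ler_poweR; rewrite ?invr_ge0 ?in_itv /= ?andbT ?leey ?andbT //.
- by apply: integral_ge0 => x _; rewrite lee_fin powR_ge0.
- by apply: integral_ge0 => x _; rewrite lee_fin powR_ge0.
apply: ge0_le_integral => //.
- apply/measurable_EFinP/(measurableT_comp (measurable_powR 2)).
  exact: measurableT_comp.
- apply/measurable_EFinP/(measurableT_comp (measurable_powR 2)).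
  by apply: measurableT_comp => //; exact: measurable_funD.
move=> x _; rewrite lee_fin ge0_ler_powR ?nnegrE//.
have normc_ge0 (z : R[i]) : 0 <= Normc.normc z.
  by case: z => a b; exact: sqrtr_ge0.
rewrite !ger0_norm ?addr_ge0//.
apply: le_trans (le_normcD _ _) _.
by rewrite lerD2l normcN.
Qed.

Lemma L2norm_eq0 f : L2 mu f -> L2norm mu f = 0%E ->
  {ae mu, forall x : borel X, f x = 0}.
Proof.
move=> /L2_measurable_normc/measurable_EFinP mf /(Lnorm_eq0_eq0 mf).
rewrite lte_fin ltr0n => /(_ isT).
by apply: filterS => x /(_ I) [] /Normc.eq0_normc.
Qed.

Lemma subspace_sub H f g : closed_subspace_of_continuous mu H ->
  H f -> H g -> H (fun x => f x - g x).
Proof.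
move=> cH Hf Hg; have := cs_linear cH (-1) Hg Hf.
by congr (H _); apply/funext => x; rewrite mulN1r addrC.
Qed.

Lemma subspace_sum H (I : Type) (r : seq I) (P : pred I) (a : I -> R[i])
    (u : I -> X -> R[i]) : closed_subspace_of_continuous mu H ->
  (forall i, H (u i)) -> H (fun x => \sum_(i <- r | P i) a i * u i x).
Proof.
move=> cH Hu; elim: r => [|i r IHr].
  by have := cs_zero cH; congr (H _); apply/funext => x; rewrite big_nil.
case Pi: (P i).
  have := cs_linear cH (a i) (Hu i) IHr.
  by congr (H _); apply/funext => x; rewrite big_cons Pi.
by move: IHr; congr (H _); apply/funext => x; rewrite big_cons Pi.
Qed.

Context {J : countType}.
Implicit Types (F : J -> X -> R[i]) (P : pred J).

(** The distance between two sums is at most the sum of their distances to any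
    finite partial sum, which tends to 0.  Terms are taken in H so that the
    partial sums are measurable. *)
Lemma sums_to_unique H P (a : J -> R[i]) F s s' :
  closed_subspace_of_continuous mu H -> (forall j, H (F j)) ->
  H s -> H s' ->
  sums_to mu P (fun j x => a j * F j x) s ->
  sums_to mu P (fun j x => a j * F j x) s' -> s = s'.
Proof.
move=> cH HF Hs Hs' ss ss'.
have Hd := subspace_sub cH Hs Hs'.
have HS h (S : {fset J}) : H h ->
    H (fun x => h x - \sum_(j <- S | P j) a j * F j x).
  by move=> Hh; apply: subspace_sub => //; exact: subspace_sum.
have dist0 : L2norm mu (fun x => s x - s' x) = 0%E.
  apply/eqP; rewrite eq_le Lnorm_ge0 andbT.
  have FF := @summability.totally_filter J.
  have lim0 := cvgeD (isT : (0 +? 0)%E) ss ss'; rewrite adde0 in lim0.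
  apply: (cvge_to_ge (lim0 _)); apply: nearW => S /=.
  have -> : (fun x => s x - s' x) =
      (fun x => (s x - \sum_(j <- S | P j) a j * F j x) -
                (s' x - \sum_(j <- S | P j) a j * F j x)).
    by apply/funext => x; rewrite opprB addrA subrK.
  apply: L2norm_triangle; apply: (cs_L2 cH); [exact: HS|exact: HS|].
  exact: subspace_sub (HS _ _ Hs) (HS _ _ Hs').
apply: (cs_separated cH) => //.
apply: filterS (L2norm_eq0 (cs_L2 cH Hd) dist0) => x.
exact: subr0_eq.
Qed.

(** As soon as a finite set S contains L, the error of the full expansion at S
    is the very same function as the error of the truncated one, so the two
    nets of norms agree eventually. *)
Lemma sums_to_remove (u : J -> X -> R[i]) (L : {fset J}) s :
  sums_to mu predT u s ->
  sums_to mu [pred j | j \notin L] u (fun x => s x - \sum_(j <- L) u j x).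
Proof.
move=> ss; have FF := @summability.totally_filter J.
apply: cvg_trans ss; apply: near_eq_cvg.
exists L => // S /= LS.
congr (L2norm mu _); apply/funext => x.
rewrite -addrA -opprD; congr (_ - _).
rewrite (bigID (mem L)) /=; congr (_ + _).
rewrite -big_filter; apply: perm_big.
apply: uniq_perm; rewrite ?filter_uniq ?fset_uniq // => j.
by rewrite mem_filter andb_idr// => /(fsubsetP LS).
Qed.

End SumInClosedSubspace.

(** The values f(t_j) are the frame coefficients of f, so the dual frame
    expansion sums to f, and what is left without Lambda sums to f minus
    the erased part; uniqueness identifies that with the chosen sum. *)
Lemma partial_reconstructionE (R : realType) (X : pmetricType R)
    (mu : {measure set (borel X) -> \bar R}) (H : set (X -> R[i]))
    (J : countType) (t : J -> X) (g F : J -> X -> R[i])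
    (Lambda : {fset J}) (f : X -> R[i]) :
  sampling_scheme mu H t g F -> H f ->
  partial_reconstruction mu H t F Lambda f =
    fun x => f x - \sum_(j <- Lambda) f (t j) * F j x.
Proof.
move=> ss Hf; have cH := ss_space ss.
have [[HF _] dual] := ss_dual ss.
apply: xget_subset1 => [|s s' [Hs sum_s] [Hs' sum_s']].
  split.
    exact: subspace_sub cH Hf (subspace_sum _ predT _ cH HF).
  apply: sums_to_remove.
  suff -> : (fun j x => f (t j) * F j x) =
      (fun j x => inner mu f (g j) * F j x) by exact: dual.
  by apply/funext => j; rewrite (ss_riesz ss).
exact: (sums_to_unique cH HF Hs Hs' sum_s sum_s').
Qed.

Lemma big_fset_elt (V : nmodType) (J : countType) (D : {fset J}) (u : J -> V) :
  \sum_(j <- D) u j = \sum_(i < #|{: D}|) u (elt i).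
Proof.
rewrite big_seq_fsetE /= (reindex (enum_val (A := D))) //=.
exact/onW_bij/enum_val_bij.
Qed.

Theorem theorem4p1 (R : realType) (X : pmetricType R)
    (mu : {measure set (borel X) -> \bar R}) (H : set (X -> R[i]))
    (J : countType) (t : J -> X) (g F : J -> X -> R[i])
    (Lambda Omega : {fset J}) (c : J -> J -> R[i])
    (C : 'M[R[i]]_(#|{: Omega}|, #|{: Lambda}|)) :
  sampling_scheme mu H t g F ->
  minimal_redundancy mu H g Lambda ->
  bridge_set Lambda Omega ->
  robust t F Lambda Omega ->
  C = \matrix_(j, k) (c (elt k) (elt j))^* ->
  bridge_matrix t F Lambda Omega *m C = bridge_matrix t F Lambda Lambda ->
  forall f : X -> R[i], H f ->
    let fR := partial_reconstruction mu H t F Lambda f in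
    samples t Lambda f =
      C^T *m (samples t Omega f - samples t Omega fR) + samples t Lambda fR.
Proof.
move=> ss _ _ _ _ BC f Hf fR.
have fRE x : fR x = f x - \sum_(j <- Lambda) f (t j) * F j x.
  by rewrite /fR (partial_reconstructionE Lambda ss Hf).
(* f - f_R = f_E is linear in the erased samples, with matrix B(Lambda, D)^T. *)
have erased D : samples t D f - samples t D fR =
    (bridge_matrix t F Lambda D)^T *m samples t Lambda f.
  apply/colP => k; rewrite !mxE fRE opprB addrC subrK big_fset_elt.
  by apply: eq_bigr => j _; rewrite !mxE mulrC.
by rewrite erased mulmxA -trmx_mul BC -erased subrK.
Qed.
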